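(* Let $\mathcal{D}=(\Delta_0\times\Delta_1,\mathcal{B})$ be the design constructed from $\mathcal{D}_0,\mathcal{D}_1,\mathcal{D}_2,(\psi_\beta)_{\beta\in\mathcal{L}_1}$ as described in the context, and let $G=\mathrm{Aut}(\mathcal{D})\cap(\mathrm{Sym}(\Delta_0)\wr\mathrm{Sym}(\Delta_1))$. Then $G$ is flag-transitive on $\mathcal{D}$ if and only if the following four conditions all hold. 1. $(G)\pi$ is flag-transitive on $\mathcal{D}_1$; 2. for each $j\in\Delta_1$, $(G_j)\pi_j$ is flag-transitive on $\mathcal{D}_0$; 3. for each $\beta\in\mathcal{L}_1$, $(G_\beta)\varphi_\beta$ is flag-transitive on $\mathcal{D}_2$; 4. for all $\beta\in\mathcal{L}_1$, $j\in\beta$, $\gamma\in\mathcal{L}_2$ such that $\gamma\cap\psi_\beta^{-1}(j)\ne\emptyset$, the group $(G_{\beta,\gamma,j})\pi_j$ is transitive on (the set of points of) the block $\gamma\cap\psi_\beta^{-1}(j)\in\mathcal{L}_0$.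
   Context: Input data: 1. $\mathcal{D}_0=(\Delta_0,\mathcal{L}_0)$ is a resolvable $2$-$(v_0,k_0,\lambda_0)$ design: its block set $\mathcal{L}_0$ is partitioned into a set $\mathcal{P}_0=\{P_1,\dots,P_r\}$ of $r$ parallel classes, each $P_i$ consisting of $s$ blocks that partition the point set $\Delta_0$. So $v_0=sk_0$ and $(v_0-1)\lambda_0=r(k_0-1)$. 2. $\mathcal{D}_1=(\Delta_1,\mathcal{L}_1)$ is a symmetric $2$-$(v_1,r,\lambda_1)$ design (blocks of size $r$; degenerate cases such as the $2$-$(v_1,v_1-1,v_1-2)$ design are allowed), so $(v_1-1)\lambda_1=r(r-1)$; its points are labelled $1,\dots,v_1$; together with bijections $\psi_\beta:\mathcal{P}_0\to\beta$ for $\beta\in\mathcal{L}_1$, such that for each $P\in\mathcal{P}_0$ and $i\in\Delta_1$ there is a unique $\beta\in\mathcal{L}_1$ with $\psi_\beta(P)=i$. 3. $\mathcal{D}_2=(\Delta_2,\mathcal{L}_2)$ is a transversal design: its point set is $\Delta_2=\bigcup_{P\in\mathcal{P}_0}P$ $(=\mathcal{L}_0)$, partitioned into $r$ ''groups'' of size $s$, namely the parallel classes $P\in\mathcal{P}_0$; each block has size $k_2\le r$ and meets each group in at most one point; and any two points in different groups lie in exactly $\lambda_2$ blocks. There are $b_2$ blocks and each point lies in $r_2$ blocks, where $r_2=\frac{(r-1)s\lambda_2}{k_2-1}$ and $b_2=\frac{r(r-1)s^2\lambda_2}{k_2(k_2-1)}$. Construction: for $\gamma\in\mathcal{L}_2$,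 $\beta\in\mathcal{L}_1$ and $j\in\beta$, the intersection $\gamma\cap\psi_\beta^{-1}(j)$ is either empty or a single block of the parallel class $\psi_\beta^{-1}(j)$; in the latter case it is identified with that block, regarded (as appropriate) as an element of $\Delta_2=\mathcal{L}_0$ or as a subset of $\Delta_0$. Put $$B_\beta(\gamma):=\bigcup_{j\in\beta}\big((\gamma\cap\psi_\beta^{-1}(j))\times\{j\}\big)\subseteq\Delta_0\times\Delta_1 .$$ The design $\mathcal{D}=(\Delta_0\times\Delta_1,\mathcal{B})$ has point set $\Delta_0\times\Delta_1$ and block set $\mathcal{B}$ equal to the disjoint union over $\beta\in\mathcal{L}_1$ of the sets $\mathcal{B}_\beta=\{B_\beta(\gamma)\mid\gamma\in\mathcal{L}_2\}$. Automorphisms: an automorphism of a design is a permutation of its points leaving its block set invariant. Permutations act on the right, written exponentially. $G$ is the group of all automorphisms of $\mathcal{D}$ leaving invariant the partition $\{\Delta_0\times\{i\}\mid i\in\Delta_1\}$ of the point set; a typical element of $\mathrm{Sym}(\Delta_0)\wr\mathrm{Sym}(\Delta_1)$ is $g=(h_1,\dots,h_{v_1})\sigma$ with $h_i\in\mathrm{Sym}(\Delta_0)$, $\sigma\in\mathrm{Sym}(\Delta_1)$, acting by $(\delta,j)^g=(\delta^{h_j},j^\sigma)$. For every $g\in G$ one has $\sigma\in\mathrm{Aut}(\mathcal{D}_1)$ and each $h_j$ is an automorphism of $\mathcal{D}_0$ preserving the set $\mathcal{P}_0$ of parallel classes. Notation: a flag is an incident point-block pair; a group is flag-transitive on a design if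 it acts transitively on its flags. For $j\in\Delta_1$, $G_j=\{g\in G\mid j^\sigma=j\}$; for $\beta\in\mathcal{L}_1$, $G_\beta=\{g\in G\mid\beta^\sigma=\beta\}$. The map $\pi:G\to\mathrm{Sym}(\Delta_1)$ is $(g)\pi=\sigma$, and $\pi_j:G_j\to\mathrm{Sym}(\Delta_0)$ is $(g)\pi_j=h_j$. The map $\varphi_\beta:G_\beta\to\mathrm{Sym}(\Delta_2)$ is the homomorphism, with image in $\mathrm{Aut}(\mathcal{D}_2)$, given by $(g)\varphi_\beta:\ell\mapsto\ell^{h_j}$ for $\ell\in\Delta_2$, where $j$ is the unique element of $\beta$ such that $\ell\in\psi_\beta^{-1}(j)$. $G_{\beta,\gamma,j}$ is the stabiliser, in the setwise stabiliser $G_{B_\beta(\gamma)}$ of the block $B_\beta(\gamma)$ in $G$, of the subset $(\gamma\cap\psi_\beta^{-1}(j))\times\{j\}$. *)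

(* Defs.v *)
From HB Require Import structures.
From mathcomp Require Import all_boot all_fingroup.

Set Implicit Arguments.
Unset Strict Implicit.
Unset Printing Implicit Defensive.

Import GroupScope.

(* Designs are simple: a block is a set of points, and a design is given by its
   set of blocks. *)

Definition two_design (T : finType) (v k lambda : nat) (L : {set {set T}}) :=
  [/\ #|T| = v,
      forall b, b \in L -> #|b| = k
    & forall x y, x != y -> #|[set b in L | (x \in b) && (y \in b)]| = lambda].

(* The r parallel classes partition L, and each of them consists of s blocks
   which partition the point set. *)
Definition resolvable_design (T : finType) (v k lambda r s : nat)
    (L : {set {set T}}) (P : {set {set {set T}}}) :=
  [/\ two_design v k lambda L,
      partition P L,
      #|P| = r
    & forall C, C \in P -> #|C| = s /\ partition C [set: T]].

Definition symmetric_design (T : finType) (v k lambda : nat)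
    (L : {set {set T}}) :=
  two_design v k lambda L /\ #|L| = v.

(* Transversal design on the point set X, a subset of the ambient type, with set
   of groups P.  The numbers of blocks, and of blocks on a point, are determined
   by these axioms. *)
Definition transversal_design (T : finType) (r s k lambda : nat)
    (X : {set T}) (P : {set {set T}}) (L : {set {set T}}) :=
  [/\ [/\ partition P X, #|P| = r & forall C, C \in P -> #|C| = s],
      1 < k <= r,
      0 < lambda,
      forall b, b \in L ->
        [/\ b \subset X, #|b| = k & forall C, C \in P -> #|b :&: C| <= 1]
    & forall C C' x y, C \in P -> C' \in P -> C != C' -> x \in C -> y \in C' ->
        #|[set b in L | (x \in b) && (y \in b)]| = lambda].

(* psi b maps parallel classes to points; only its values for b in L and for
   arguments in P are meaningful. *)
Definition labelling (U T : finType) (P : {set U}) (L : {set {set T}})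
    (psi : {set T} -> U -> T) :=
  [/\ forall b, b \in L -> {in P &, injective (psi b)},
      forall b, b \in L -> psi b @: P = b
    & forall C i, C \in P -> exists! b, b \in L /\ psi b C = i].

(* The wreath product Sym(T0) wr Sym(T1): a pair (h, sigma) sends (d, j) to
   (h j d, sigma j).  Products are read from left to right, as for {perm _}. *)
Record wreath (T0 T1 : finType) :=
  Wreath { wreath_val : {ffun T1 -> {perm T0}} * {perm T1} }.

HB.instance Definition _ (T0 T1 : finType) := [isNew for @wreath_val T0 T1].
HB.instance Definition _ (T0 T1 : finType) := [Finite of wreath T0 T1 by <:].

Section Wreath.

Context {T0 T1 : finType}.
Implicit Types g : wreath T0 T1.

Definition base (j : T1) g : {perm T0} := (wreath_val g).1 j.
Definition top g : {perm T1} := (wreath_val g).2.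

Definition wreath_one : wreath T0 T1 := Wreath ([ffun => 1], 1).
Definition wreath_mul g g' : wreath T0 T1 :=
  Wreath ([ffun j => base j g * base (top g j) g'], top g * top g').
Definition wreath_inv g : wreath T0 T1 :=
  Wreath ([ffun j => (base ((top g)^-1 j) g)^-1], (top g)^-1).

Lemma wreath_mulA : associative wreath_mul.
Proof.
move=> x y z; congr (Wreath (_, _)); last exact: mulgA.
by apply/ffunP=> j; rewrite !ffunE /= /base !ffunE permM mulgA.
Qed.

Lemma wreath_mul1 : left_id wreath_one wreath_mul.
Proof.
case=> -[h s]; congr (Wreath (_, _)); last exact: mul1g.
by apply/ffunP=> j; rewrite !ffunE /= /base ffunE perm1 mul1g.
Qed.

Lemma wreath_mulV : left_inverse wreath_one wreath_inv wreath_mul.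
Proof.
case=> -[h s]; congr (Wreath (_, _)); last exact: mulVg.
by apply/ffunP=> j; rewrite !ffunE /= /base ffunE mulVg.
Qed.

HB.instance Definition _ := Finite_isGroup.Build (wreath T0 T1)
  wreath_mulA wreath_mul1 wreath_mulV.

Definition wreath_fun (x : T0 * T1) g : T0 * T1 := (base x.2 g x.1, top g x.2).

Lemma wreath_fun1 : wreath_fun^~ 1 =1 id.
Proof. by case=> d j; rewrite /wreath_fun /base /= ffunE !perm1. Qed.

Lemma wreath_funM : forall x, act_morph wreath_fun x.
Proof. by case=> d j g g'; rewrite /wreath_fun /base /= ffunE !permM. Qed.

Definition wreath_act := TotalAction wreath_fun1 wreath_funM.

Definition top_fun (j : T1) g : T1 := top g j.

Lemma top_fun1 : top_fun^~ 1 =1 id.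
Proof. by move=> j; rewrite /top_fun perm1. Qed.

Lemma top_funM : forall j, act_morph top_fun j.
Proof. by move=> j g g'; rewrite /top_fun permM. Qed.

Definition top_act := TotalAction top_fun1 top_funM.

End Wreath.

Section Construction.

Context {T0 T1 : finType}.
Variables (P0 : {set {set {set T0}}}) (L1 : {set {set T1}}).
Variables (psi : {set T1} -> {set {set T0}} -> T1) (L2 : {set {set {set T0}}}).

(* psi_beta^-1(j): the parallel class labelled j, for j in beta. *)
Definition psi_inv (beta : {set T1}) (j : T1) : {set {set T0}} :=
  odflt set0 [pick C in P0 | psi beta C == j].

(* gamma meets a parallel class in at most one block of D_0; trace is this block
   as a set of points, or the empty set if there is none. *)
Definition trace (beta : {set T1}) (gamma : {set {set T0}}) (j : T1) :
  {set T0} := cover (gamma :&: psi_inv beta j).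

Definition block (beta : {set T1}) (gamma : {set {set T0}}) : {set T0 * T1} :=
  \bigcup_(j in beta) setX (trace beta gamma j) [set j].

Definition blocks : {set {set T0 * T1}} :=
  [set block beta gamma | beta in L1, gamma in L2].

Definition autG : {group wreath T0 T1} := 'N(blocks | wreath_act^*)%G.

Definition autG_point (j : T1) : {group wreath T0 T1} :=
  'C_autG[j | top_act]%G.

Definition autG_block (beta : {set T1}) : {group wreath T0 T1} :=
  'N_autG(beta | top_act)%G.

(* phi_beta(g) sends the point l of D_2 to l^{h_j}, where the parallel class of
   l has label j. *)
Definition phi (beta : {set T1}) (g : wreath T0 T1) (l : {set T0}) : {set T0} :=
  base (psi beta (pblock P0 l)) g @: l.

Definition autG_trace (beta : {set T1}) (gamma : {set {set T0}}) (j : T1) :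
    {group wreath T0 T1} :=
  ('N_autG(block beta gamma | wreath_act)
     :&: 'N(setX (trace beta gamma j) [set j] | wreath_act))%G.

End Construction.

(* The permutations f g, for g in A, act transitively on the flags of the design
   with set of blocks L. *)
Definition flag_transitive (gT T : finType) (A : {set gT}) (f : gT -> T -> T)
    (L : {set {set T}}) :=
  forall x b y c, b \in L -> x \in b -> c \in L -> y \in c ->
    exists2 g, g \in A & f g x = y /\ f g @: b = c.

(* Main.v *)
Require Import Defs.
From mathcomp Require Import all_boot all_fingroup.

Import GroupScope.

(**
Call a pair (l, j), with l a block of D_0 and j a point of D_1, a piece. Each
piece occurs in a block of D and determines, by the labelling axiom, the beta
for which this happens. Two points of D_2 in different groups lie in a common
block and there are at least two groups, so the pieces belonging to a given
beta are the connected components of the relation "lie in a common block of D".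
An element g of G permutes the pieces and preserves this relation, hence maps
the component of beta to that of beta^g, and B_beta(gamma) to
B_{beta^g}(gamma^{phi_beta(g)}). Both directions follow by moving a flag one
coordinate at a time.
*)

Lemma setact_astabs (aT : finGroupType) (rT : finType) (to : {action aT &-> rT})
  (S : {set rT}) a : to^* S a = S -> a \in 'N(S | to).
Proof. by rewrite -astab1_set => /astab1P. Qed.

(* The permutations [base j g] need not be given as a group, so transitivity is
   transferred to the action of [H] on the pairs [(x, j)]. *)
Lemma transitive_base {T0 T1 : finType} {H : {group wreath T0 T1}}
    {S : {set T0}} {j : T1} :
    H \subset 'N(setX S [set j] | wreath_act) ->
    [transitive [set base j g | g in H], on S | 'P] ->
  {in S &, forall x y, exists2 g, g \in H & wreath_act (x, j) g = (y, j)}.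
Proof.
move=> /subsetP HS /imsetP[x0 x0S defS].
(* The image of (x0, j) stays in S x {j}, so each g in H fixes j. *)
have actE g : g \in H -> wreath_act (x0, j) g = (base j g x0, j).
  move=> gH; have := astabs_act (x0, j) (HS g gH).
  by rewrite !inE x0S eqxx /= /wreath_fun /= => /andP[_ /eqP ->].
move=> x y; rewrite {1 2}defS => /imsetP[_ /imsetP[g gH ->] ->].
case/imsetP=> _ /imsetP[h hH ->] ->.
exists (g^-1 * h); first by rewrite groupM ?groupV.
by rewrite actM /aperm -!actE // actK.
Qed.

(** For a fixed beta a piece (l, j) is determined by l, with j = [label beta l]; working with l
    avoids the default value of [psi_inv]. *)
Definition label {T0 T1 : finType} (P0 : {set {set {set T0}}})
    (psi : {set T1} -> {set {set T0}} -> T1) (beta : {set T1})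
    (l : {set T0}) : T1 :=
  psi beta (pblock P0 l).

Section Pieces.

Context {T0 T1 : finType} {r s k2 lambda2 : nat} {L0 : {set {set T0}}}
  {P0 : {set {set {set T0}}}} {L1 : {set {set T1}}}
  {psi : {set T1} -> {set {set T0}} -> T1} {L2 : {set {set {set T0}}}}.
Context (L0_neq0 : set0 \notin L0) (psiP : labelling P0 L1 psi)
  (D2P : transversal_design r s k2 lambda2 L0 P0 L2).

Implicit Types (beta : {set T1}) (gamma : {set {set T0}}) (l m : {set T0})
  (g : wreath T0 T1).

Local Notation G := (autG P0 L1 psi L2).

Local Notation label := (label P0 psi).

(** * Groups of D_2 and their labels *)

Lemma group_partition : partition P0 L0.
Proof. by case: D2P => -[]. Qed.

Lemma pblock_group {l} : l \in L0 -> pblock P0 l \in P0.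
Proof.
by move=> lL; rewrite pblock_mem // (cover_partition group_partition).
Qed.

Lemma mem_pblock_group {l} : l \in L0 -> l \in pblock P0 l.
Proof. by move=> lL; rewrite mem_pblock (cover_partition group_partition). Qed.

Lemma block_sub {gamma l} : gamma \in L2 -> l \in gamma -> l \in L0.
Proof.
by case: D2P => _ _ _ sub _ /sub[/subsetP gL _ _]; apply: gL.
Qed.

Lemma exists_mem {gamma} : gamma \in L2 -> exists l, l \in gamma.
Proof.
case: D2P => _ /andP[k2_gt1 _] _ bl _ /bl[_ cardg _].
by apply/card_gt0P; rewrite cardg ltnW.
Qed.

Lemma exists_point {l} : l \in L0 -> exists d, d \in l.
Proof.
by move=> lL; apply/set0Pn; apply: contraNneq L0_neq0 => <-.
Qed.

Lemma label_mem {beta l} : beta \in L1 -> l \in L0 -> label beta l \in beta.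
Proof.
case: psiP => _ im _ bL lL.
by have := imset_f (psi beta) (pblock_group lL); rewrite im.
Qed.

Lemma card_L1 {beta} : beta \in L1 -> #|beta| = #|P0|.
Proof.
case: psiP => inj im _ bL.
by rewrite -[in LHS](im _ bL) card_in_imset //; apply: inj.
Qed.

Lemma labelP {beta j} : beta \in L1 -> j \in beta ->
  exists2 l, l \in L0 & label beta l = j.
Proof.
case: psiP => _ im _ bL jb.
have : j \in psi beta @: P0 by rewrite im.
case/imsetP=> C CP ->.
case/and3P: group_partition => /eqP covP tiP P_neq0.
have /set0Pn[l lC] : C != set0 by apply: contraNneq P_neq0 => <-.
exists l; first by rewrite -covP; apply/bigcupP; exists C.
by rewrite /label (def_pblock tiP CP lC).
Qed.

Lemma label_inj {beta beta' l} : beta \in L1 -> beta' \in L1 -> l \in L0 ->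
  label beta l = label beta' l -> beta = beta'.
Proof.
case: psiP => _ _ uniq bL b'L lL eq_lab.
have [b [_ bU]] := uniq _ (label beta l) (pblock_group lL).
by rewrite -(bU beta) // -(bU beta').
Qed.

Lemma label_onto j {l} : l \in L0 ->
  exists2 beta, beta \in L1 & label beta l = j.
Proof.
case: psiP => _ _ uniq lL.
by have [b [[bL lab] _]] := uniq _ j (pblock_group lL); exists b.
Qed.

(** * From labels to the blocks of D *)

Lemma psi_inv_label {beta l} : beta \in L1 -> l \in L0 ->
  psi_inv P0 psi beta (label beta l) = pblock P0 l.
Proof.
case: psiP => inj _ _ bL lL; rewrite /psi_inv.
case: pickP => /= [C|/(_ (pblock P0 l))].
  by case/andP=> CP /eqP /(inj _ bL); apply; rewrite ?pblock_group.
by rewrite pblock_group ?eqxx.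
Qed.

(** The group of l meets gamma in at most one point, and l is such a point, so the union in [trace]
    has the single term l. *)
Lemma trace_label {beta gamma l} : beta \in L1 -> gamma \in L2 -> l \in gamma ->
  trace P0 psi beta gamma (label beta l) = l.
Proof.
move=> bL gL lg; have lL := block_sub gL lg.
rewrite /trace psi_inv_label //.
have lI : l \in gamma :&: pblock P0 l by rewrite inE lg mem_pblock_group.
case: D2P => _ _ _ /(_ _ gL)[_ _ /(_ _ (pblock_group lL))] le1 _.
suff -> : gamma :&: pblock P0 l = [set l] by rewrite /cover big_set1.
by apply/eqP; rewrite eq_sym eqEcard sub1set lI cards1.
Qed.

Lemma trace_neq0 {beta gamma j} : beta \in L1 -> gamma \in L2 -> j \in beta ->
  gamma :&: psi_inv P0 psi beta j != set0 ->
  exists2 l, l \in gamma & label beta l = j.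
Proof.
move=> bL gL jb /set0Pn[l]; rewrite inE => /andP[lg].
have [m mL <-] := labelP bL jb; rewrite psi_inv_label // => lm; exists l => //.
case/and3P: group_partition => _ tiP _.
by rewrite /label (def_pblock tiP (pblock_group mL) lm).
Qed.

Lemma mem_block {beta gamma} d j :
  ((d, j) \in block P0 psi beta gamma)
    = (j \in beta) && (d \in trace P0 psi beta gamma j).
Proof.
apply/bigcupP/andP => [[i ib]|[jb dj]]; last first.
  by exists j => //; rewrite !inE dj /=.
by rewrite !inE /= => /andP[di /eqP ->].
Qed.

Lemma mem_block_label {beta gamma l} d :
    beta \in L1 -> gamma \in L2 -> l \in gamma ->
  ((d, label beta l) \in block P0 psi beta gamma) = (d \in l).
Proof.
by move=> bL gL lg; rewrite mem_block label_mem ?trace_label ?(block_sub gL lg).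
Qed.

Lemma blockP {beta gamma d j} : beta \in L1 -> gamma \in L2 ->
  (d, j) \in block P0 psi beta gamma ->
  exists l, [/\ l \in gamma, d \in l & label beta l = j].
Proof.
move=> bL gL; rewrite mem_block => /andP[jb dj].
have [|l lg lab] := trace_neq0 bL gL jb.
  by apply: contraTneq dj => I0; rewrite /trace I0 /cover big_set0 inE.
by exists l; split=> //; rewrite -(trace_label bL gL lg) lab.
Qed.

(** A point d of l lies in a piece m of the block with label j, and the whole fibre over j is then
    m. Thus pieces can be read off from sets of points. *)
Lemma block_fibre {beta gamma l j} : beta \in L1 -> gamma \in L2 -> l != set0 ->
    (forall d, ((d, j) \in block P0 psi beta gamma) = (d \in l)) ->
  l \in gamma /\ label beta l = j.
Proof.
move=> bL gL /set0Pn[d dl] memE.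
have := memE d; rewrite dl => /(blockP bL gL)[m [mg _ labm]].
suff <- : m = l by [].
by apply/setP=> z; rewrite -memE -labm mem_block_label.
Qed.

(** * Connectedness of the transversal design *)

Lemma common_block {l m} : l \in L0 -> m \in L0 -> pblock P0 l != pblock P0 m ->
  exists gamma, [/\ gamma \in L2, l \in gamma & m \in gamma].
Proof.
move=> lL mL neq; case: D2P => _ _ lam_gt0 _ lamE.
have := lamE _ _ l m (pblock_group lL) (pblock_group mL) neq
  (mem_pblock_group lL) (mem_pblock_group mL).
move=> cardE.
have : 0 < #|[set b in L2 | (l \in b) && (m \in b)]| by rewrite cardE.
by case/card_gt0P=> gamma; rewrite inE => /and3P[]; exists gamma.
Qed.

(** Since 1 < [k2] <= r, there are at least two groups. *)
Lemma other_group {C} : C \in P0 -> exists2 m, m \in L0 & pblock P0 m != C.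
Proof.
move=> CP; case: D2P => -[_ cardP _] /andP[k2_gt1 k2_le] _ _ _.
have : 0 < #|P0 :\ C|.
  by move: (leq_trans k2_gt1 k2_le); rewrite -cardP (cardsD1 C) CP.
case/card_gt0P=> C'; rewrite !inE => /andP[neq C'P].
case/and3P: group_partition => /eqP covP tiP P_neq0.
have /set0Pn[m mC'] : C' != set0 by apply: contraNneq P_neq0 => <-.
exists m; first by rewrite -covP; apply/bigcupP; exists C'.
by rewrite (def_pblock tiP C'P mC').
Qed.

Lemma exists_block {l} : l \in L0 -> exists2 gamma, gamma \in L2 & l \in gamma.
Proof.
move=> lL; have [m mL neq] := other_group (pblock_group lL).
have [|gamma [gL lg _]] := common_block lL mL; first by rewrite eq_sym.
by exists gamma.
Qed.

(** * The action of G on blocks *)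

Lemma mem_act_block {beta gamma} g d j :
  ((base j g d, top g j) \in wreath_act^* (block P0 psi beta gamma) g)
    = ((d, j) \in block P0 psi beta gamma).
Proof. exact: (mem_imset _ (d, j) (act_inj wreath_act g)). Qed.

(** Being bijective, g maps the fibre of a piece onto a full fibre of the image block, which is
    again a piece by [block_fibre]. Here beta' may still depend on gamma. *)
Lemma autG_block_image {g beta gamma} :
    g \in G -> beta \in L1 -> gamma \in L2 ->
  exists beta' gamma', [/\ beta' \in L1, gamma' \in L2,
    wreath_act^* (block P0 psi beta gamma) g = block P0 psi beta' gamma',
    phi P0 psi beta g @: gamma = gamma'
    & forall l, l \in gamma ->
        label beta' (phi P0 psi beta g l) = top g (label beta l)].
Proof.
move=> gG bL gL.
have : wreath_act^* (block P0 psi beta gamma) g \in blocks P0 L1 psi L2.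
  by rewrite (astabs_act _ gG) imset2_f.
case/imset2P=> beta' gamma' b'L g'L imE; exists beta', gamma'.
have piece l : l \in gamma -> phi P0 psi beta g l \in gamma' /\
    label beta' (phi P0 psi beta g l) = top g (label beta l).
  move=> lg; apply: block_fibre => // [|z].
    have [d dl] := exists_point (block_sub gL lg).
    by apply/set0Pn; exists (base (label beta l) g d); apply: imset_f.
  rewrite -imE -[z](permKV (base (label beta l) g)) mem_act_block.
  rewrite mem_block_label //.
  by rewrite /phi mem_imset //; apply: perm_inj.
split=> // [|l /piece[]//].
apply/eqP; rewrite eqEsubset; apply/andP; split.
  by apply/subsetP=> _ /imsetP[l /piece[lg' _] ->].
(* A point of the piece of m comes from a piece l of the original block. The image of l and m both
   lie in gamma' with the same label, hence coincide. *)
apply/subsetP=> m mg'; have [z zm] := exists_point (block_sub g'L mg').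
have := mem_block_label z b'L g'L mg'; rewrite zm -imE.
case/imsetP=> -[d j] /(blockP bL gL)[l [lg _ <-]] [_ labm].
have [lg' lab] := piece l lg; apply/imsetP; exists l => //.
by rewrite -(trace_label b'L g'L mg') labm -lab trace_label.
Qed.

(* The connectedness step: two points of D_2 in the same group are linked
   through any point of another group. *)
Lemma autG_component {g beta} : g \in G -> beta \in L1 ->
  exists2 beta', beta' \in L1 & forall l, l \in L0 ->
    phi P0 psi beta g l \in L0
      /\ label beta' (phi P0 psi beta g l) = top g (label beta l).
Proof.
move=> gG bL.
have linked l m : l \in L0 -> m \in L0 -> pblock P0 l != pblock P0 m ->
    exists beta', [/\ beta' \in L1, phi P0 psi beta g l \in L0,
      label beta' (phi P0 psi beta g l) = top g (label beta l),
      phi P0 psi beta g m \in L0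
      & label beta' (phi P0 psi beta g m) = top g (label beta m)].
  move=> lL mL /(common_block lL mL)[gamma [gL lg mg]].
  have [beta' [gamma' [b'L g'L _ imE lab]]] := autG_block_image gG bL gL.
  exists beta'; split; rewrite ?lab //; apply: (block_sub g'L);
    by rewrite -imE imset_f.
(* The reference points l0 and m0 exist once D_2 has a point; otherwise the claim about l is
   vacuous. *)
case: (set_0Vmem L0) => [L0_eq0|[l0 l0L]].
  by exists beta => // l; rewrite L0_eq0 inE.
have [m0 m0L neq0] := other_group (pblock_group l0L).
rewrite eq_sym in neq0.
have [beta' [b'L l0' lab0 m0' labm]] := linked _ _ l0L m0L neq0.
exists beta' => // l lL.
(* In each case the two linked pairs share a point, m0 or l0. Its image has the same label under
   both candidates for beta', so [label_inj] equates them. *)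
have [eq_l|neq_l] := eqVneq (pblock P0 l) (pblock P0 l0).
  rewrite -eq_l in neq0.
  have [b [bL1 l' lab _ labm']] := linked _ _ lL m0L neq0.
  by rewrite (label_inj b'L bL1 m0') // labm labm'.
have [b [bL1 l' lab _ lab0']] := linked _ _ lL l0L neq_l.
by rewrite (label_inj b'L bL1 l0') // lab0 lab0'.
Qed.

(** The labels of points of D_2 fill beta and are sent into beta', and all blocks of D_1 have the
    size of [P0], so beta' is the image of beta. One piece of gamma then shows that the beta'
    attached to its block is the same. *)
Lemma autG_image {g beta} : g \in G -> beta \in L1 ->
  [/\ top g @: beta \in L1,
      forall l, l \in L0 -> phi P0 psi beta g l \in L0
        /\ label (top g @: beta) (phi P0 psi beta g l) = top g (label beta l)
    & forall gamma, gamma \in L2 -> phi P0 psi beta g @: gamma \in L2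
        /\ wreath_act^* (block P0 psi beta gamma) g
           = block P0 psi (top g @: beta) (phi P0 psi beta g @: gamma)].
Proof.
move=> gG bL; have [beta' b'L lab] := autG_component gG bL.
have topE : top g @: beta = beta'.
  apply/eqP; rewrite eqEcard card_imset; last exact: perm_inj.
  rewrite (card_L1 bL) (card_L1 b'L).
  rewrite leqnn andbT; apply/subsetP=> _ /imsetP[j jb ->].
  have [l lL <-] := labelP bL jb; have [l'L <-] := lab l lL.
  exact: label_mem.
rewrite topE; split=> // gamma gL.
have [b [gamma' [bL1 g'L actE imE lab']]] := autG_block_image gG bL gL.
rewrite imE actE; split=> //; congr block.
have [l lg] := exists_mem gL.
have [l'L labl] := lab l (block_sub gL lg).
by apply: (label_inj bL1 b'L l'L); rewrite labl lab'.
Qed.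

(** * Flags of D *)

Lemma block_inj {beta beta' gamma gamma'} :
    beta \in L1 -> gamma \in L2 -> beta' \in L1 -> gamma' \in L2 ->
  block P0 psi beta gamma = block P0 psi beta' gamma' ->
  beta = beta' /\ gamma = gamma'.
Proof.
move=> bL gL b'L g'L eqB.
(* Comparing fibres over each label recovers the pieces, and a single piece already fixes beta. *)
have piece l : l \in gamma -> l \in gamma' /\ label beta' l = label beta l.
  move=> lg; apply: block_fibre => // [|d].
    by apply: contraNneq L0_neq0 => <-; apply: block_sub lg.
  by rewrite -eqB mem_block_label.
have [l lg] := exists_mem gL; have [_ lab] := piece l lg.
have eqb := label_inj b'L bL (block_sub gL lg) lab; split=> //.
apply/setP=> m; apply/idP/idP => [/piece[]//|mg'].
have m_neq0 : m != set0.
  by apply: contraNneq L0_neq0 => <-; apply: block_sub mg'.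
have [|//] := block_fibre bL gL m_neq0 (j := label beta m).
by move=> d; rewrite eqB -eqb mem_block_label.
Qed.

(** This splits a moved flag of D into moved flags of D_1 and D_2. The image of l is l' because both
    lie in gamma' with the same label. *)
Lemma flag_image {beta beta' gamma gamma' l l' d d' g} :
    beta \in L1 -> gamma \in L2 -> beta' \in L1 -> gamma' \in L2 ->
    l \in gamma -> l' \in gamma' -> g \in G ->
    wreath_act (d, label beta l) g = (d', label beta' l') ->
    wreath_act^* (block P0 psi beta gamma) g = block P0 psi beta' gamma' ->
  [/\ top g @: beta = beta', phi P0 psi beta g @: gamma = gamma'
    & phi P0 psi beta g l = l'].
Proof.
move=> bL gL b'L g'L lg l'g' gG [_ labE] actE.
have [tL lab /(_ _ gL)[pL]] := autG_image gG bL.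
rewrite actE => /(block_inj b'L g'L tL pL)[eqb eqg]; split=> //.
have [_ labl] := lab l (block_sub gL lg).
rewrite -(trace_label b'L g'L l'g') -labE -labl -eqb trace_label //.
by rewrite eqg imset_f.
Qed.

(** By [blockP], a flag of D amounts to some beta and a chain d in l in gamma, the second coordinate
    of its point being the label of l. *)
Lemma flag_transitiveP :
  flag_transitive G (fun g x => wreath_act x g) (blocks P0 L1 psi L2) <->
  forall beta beta' gamma gamma' l l' d d',
    beta \in L1 -> gamma \in L2 -> beta' \in L1 -> gamma' \in L2 ->
    l \in gamma -> l' \in gamma' -> d \in l -> d' \in l' ->
  exists g, [/\ g \in G, wreath_act (d, label beta l) g = (d', label beta' l')
    & wreath_act^* (block P0 psi beta gamma) g = block P0 psi beta' gamma'].
Proof.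
split=> [ft beta beta' gamma gamma' l l' d d' bL gL b'L g'L lg l'g' dl d'l'|ft].
  have [||||g gG [xE BE]] := ft (d, label beta l) (block P0 psi beta gamma)
    (d', label beta' l') (block P0 psi beta' gamma').
  - exact: imset2_f.
  - by rewrite mem_block_label.
  - exact: imset2_f.
  - by rewrite mem_block_label.
  by exists g.
move=> [d j] b [d' j'] c.
case/imset2P=> beta gamma bL gL -> /(blockP bL gL)[l [lg dl <-]].
move=> /imset2P[beta' gamma' b'L g'L ->] /(blockP b'L g'L)[l' [l'g' d'l' <-]].
have [g [gG xE BE]] := ft _ _ _ _ _ _ _ _ bL gL b'L g'L lg l'g' dl d'l'.
by exists g.
Qed.

End Pieces.

Theorem theorem5p4 (T0 T1 : finType)
  (v0 k0 lambda0 r s v1 lambda1 k2 lambda2 : nat)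
  (L0 : {set {set T0}}) (P0 : {set {set {set T0}}})
  (L1 : {set {set T1}}) (psi : {set T1} -> {set {set T0}} -> T1)
  (L2 : {set {set {set T0}}})
  (D0_design : resolvable_design v0 k0 lambda0 r s L0 P0)
  (D1_design : symmetric_design v1 r lambda1 L1)
  (psi_labelling : labelling P0 L1 psi)
  (D2_design : transversal_design r s k2 lambda2 L0 P0 L2) :
  flag_transitive (autG P0 L1 psi L2) (fun g x => wreath_act x g)
    (blocks P0 L1 psi L2)
  <->
  [/\ flag_transitive (autG P0 L1 psi L2) (fun g => top g) L1,
      forall j : T1,
        flag_transitive (autG_point P0 L1 psi L2 j) (fun g => base j g) L0,
      forall beta : {set T1}, beta \in L1 ->
        flag_transitive (autG_block P0 L1 psi L2 beta) (phi P0 psi beta) L2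
    & forall (beta : {set T1}) (j : T1) (gamma : {set {set T0}}),
        beta \in L1 -> j \in beta -> gamma \in L2 ->
        gamma :&: psi_inv P0 psi beta j != set0 ->
        [transitive [set base j g | g in autG_trace P0 L1 psi L2 beta gamma j],
           on trace P0 psi beta gamma j | 'P]].

Proof.
(* Every block of D_0 is in a parallel class, and the parts of a partition are nonempty. *)
have L0_neq0 : set0 \notin L0.
  case: D0_design => _ partP _ cls; case/and3P: partP => /eqP <- _ _.
  apply/bigcupP=> -[C CP]; have [_ /and3P[_ _ /negbTE->]] := cls C CP.
  by [].
have flagP := flag_transitiveP psi_labelling D2_design.
split=> [/flagP ft|[ft1 _ ft3 ft4]].
  split.
  (* Condition 1: extend both flags of D_1 to flags of D. *)
  - move=> j beta j' beta' bL jb b'L j'b'.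
    have [l lL <-] := labelP psi_labelling D2_design bL jb.
    have [l' l'L <-] := labelP psi_labelling D2_design b'L j'b'.
    have [gamma gL lg] := exists_block D2_design lL.
    have [gamma' g'L l'g'] := exists_block D2_design l'L.
    have [d dl] := exists_point L0_neq0 lL.
    have [d' d'l'] := exists_point L0_neq0 l'L.
    have [g [gG xE BE]] := ft _ _ _ _ _ _ _ _ bL gL b'L g'L lg l'g' dl d'l'.
    have [topE _ _] :=
      flag_image L0_neq0 psi_labelling D2_design bL gL b'L g'L lg l'g' gG xE BE.
    by exists g => //; case: xE.
  (* Condition 2: for each of l and l', choose the beta that gives it the label j; the element found
     then fixes j. *)
  - move=> j d l d' l' lL dl l'L d'l'.
    have [beta bL lab] := label_onto psi_labelling D2_design j lL.
    have [beta' b'L lab'] := label_onto psi_labelling D2_design j l'L.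
    have [gamma gL lg] := exists_block D2_design lL.
    have [gamma' g'L l'g'] := exists_block D2_design l'L.
    have [g [gG xE BE]] := ft _ _ _ _ _ _ _ _ bL gL b'L g'L lg l'g' dl d'l'.
    have [_ _ phiE] :=
      flag_image L0_neq0 psi_labelling D2_design bL gL b'L g'L lg l'g' gG xE BE.
    move: xE phiE; rewrite /phi -/(label P0 psi beta l) lab lab' => -[dE jE] lE.
    by exists g => //; rewrite inE gG; apply/astab1P.
  (* Condition 3: both flags of D use the same beta, so g stabilises it. *)
  - move=> beta bL l gamma l' gamma' gL lg g'L l'g'.
    have lL := block_sub D2_design gL lg.
    have l'L := block_sub D2_design g'L l'g'.
    have [d dl] := exists_point L0_neq0 lL.
    have [d' d'l'] := exists_point L0_neq0 l'L.
    have [g [gG xE BE]] := ft _ _ _ _ _ _ _ _ bL gL bL g'L lg l'g' dl d'l'.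
    have [topE gE lE] :=
      flag_image L0_neq0 psi_labelling D2_design bL gL bL g'L lg l'g' gG xE BE.
    exists g => //; apply/setIP; split=> //.
    exact: setact_astabs.
  (* Condition 4: only the point d moves inside l, while beta, gamma and l are kept. *)
  - move=> beta j gamma bL jb gL.
    case/(trace_neq0 psi_labelling D2_design bL gL jb) => l lg <-.
    rewrite (trace_label psi_labelling D2_design) //.
    have [d dl] := exists_point L0_neq0 (block_sub D2_design gL lg).
    apply/imsetP; exists d => //; apply/setP=> d'.
    apply/idP/imsetP => [d'l|[a]].
      have [g [gG xE BE]] := ft _ _ _ _ _ _ _ _ bL gL bL gL lg lg dl d'l.
      have [_ _ lE] :=
        flag_image L0_neq0 psi_labelling D2_design bL gL bL gL lg lg gG xE BE.
      case: xE => dE jE.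
      exists (base (label P0 psi beta l) g); last by rewrite -dE.
      apply/imsetP; exists g => //; apply/setIP; split.
        by apply/setIP; split; last exact: setact_astabs.
      apply: setact_astabs; rewrite (trace_label psi_labelling D2_design) //.
      apply/eqP; rewrite eqEcard card_setact leqnn andbT.
      apply/subsetP=> _ /imsetP[[z i] /setXP[/= zl /set1P->] ->].
      by rewrite -{2}lE !inE /= imset_f // jE eqxx.
    case/imsetP=> g; case/setIP=> _ /astabs_act act_l -> ->.
    have := act_l (d, label P0 psi beta l).
    rewrite (trace_label psi_labelling D2_design) // !inE dl eqxx /=.
    by case/andP.
apply/flagP => beta beta' gamma gamma' l l' d d' bL gL b'L g'L lg l'g' dl d'l'.
have lL := block_sub D2_design gL lg.
have l'L := block_sub D2_design g'L l'g'.
have lb := label_mem psi_labelling D2_design bL lL.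
have l'b := label_mem psi_labelling D2_design b'L l'L.
(* Condition 1 gives g1 adjusting beta and the label; l and gamma become [l1] and its image
   block. *)
have [g1 g1G [top1 top1b]] := ft1 _ _ _ _ bL lb b'L l'b.
have [_ /(_ l lL)[_ lab1] /(_ gamma gL)[g1L act1]] :=
  autG_image L0_neq0 psi_labelling D2_design g1G bL.
rewrite top1b ?top1 in lab1 act1; set l1 := phi _ _ _ _ l in lab1.
have l1g : l1 \in phi P0 psi beta g1 @: gamma by apply: imset_f.
(* Condition 3 gives g2 fixing beta' and sending [l1] to l'. Both have the same label, so g2 fixes
   that label too. *)
have [g2 + [l1E gE]] := ft3 beta' b'L _ _ _ _ g1L l1g g'L l'g'.
case/setIP=> g2G /astabs_setact top2b.
have [_ /(_ l1 (block_sub D2_design g1L l1g))[_ top2] /(_ _ g1L)[_ act2]] :=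
  autG_image L0_neq0 psi_labelling D2_design g2G b'L.
have {}top2b : top g2 @: beta' = beta' by [].
rewrite top2b ?gE ?l1E ?lab1 in act2 top2.
set z := base (label P0 psi beta' l') g2 (base (label P0 psi beta l) g1 d).
have zl' : z \in l'.
  by rewrite -l1E /phi -/(label P0 psi beta' l1) lab1 !imset_f.
have l'_neq0 : gamma' :&: psi_inv P0 psi beta' (label P0 psi beta' l') != set0.
  apply/set0Pn; exists l'.
  rewrite inE l'g' (psi_inv_label psi_labelling D2_design) //.
  exact: (mem_pblock_group D2_design).
have traceE := trace_label psi_labelling D2_design b'L g'L l'g'.
(* Now d has reached z in l'. Condition 4 gives g3 taking z to d' while fixing the block and the
   label. *)
have := transitive_base (subsetIr _ _) (ft4 _ _ _ b'L l'b g'L l'_neq0).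
rewrite traceE => /(_ z d' zl' d'l')[g3].
case/setIP=> /setIP[g3G /astabs_setact act3] _ d'E.
exists (g1 * g2 * g3); split.
- by rewrite !groupM.
- rewrite !actM -d'E [wreath_act (d, _) g1]/= /wreath_fun /= top1.
  by rewrite /wreath_fun /= -top2.
by rewrite !actM /= act1 act2.
Qed.
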